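(* Consider problem (rank-MOA) $\min\{f(X):\mathcal{A}(X)=b,\ \operatorname{rank}(X)\le r\}$ and let $X\in\mathcal{L}\cap\mathcal{M}(r)$ with $s=\operatorname{rank}(X)$ and SVD $X=U\Sigma V^\top$ as in the context. (i) Suppose $X$ is a local minimizer of (rank-MOA). If either $s=r$ and Assumption 1 holds at $X$, or $s<r$ and Assumption 2 holds at $X$, then $X$ is an $F$-stationary point of (rank-MOA). (ii) Suppose $f$ is convex and $X$ is an $F$-stationary point of (rank-MOA). If $s=r$, then $f(X)\le f(Y)$ for all $Y\in\mathcal{L}\cap\mathcal{M}_X(\Gamma)$, where $\mathcal{M}_X(\Gamma)=\{UBV_\Gamma^\top:B\in\mathbb{R}^{m\times r}\}$. If $s<r$, then $X$ is a global minimizer of (rank-MOA).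
   Context: $0\le r<n\le m$. $\langle X,Y\rangle=\sum_{i,j}X_{ij}Y_{ij}$. $f:\mathbb{R}^{m\times n}\to\mathbb{R}$ continuously differentiable; $A^1,\dots,A^l\in\mathbb{R}^{m\times n}$, $b\in\mathbb{R}^l$, $\mathcal{A}(X)=(\langle A^1,X\rangle,\dots,\langle A^l,X\rangle)^\top$, $\mathcal{L}=\{X:\mathcal{A}(X)=b\}$, $\mathcal{M}(r)=\{X:\operatorname{rank}X\le r\}$. Lagrangian $L(X;y)=f(X)+\sum_{i=1}^ly_i(\langle A^i,X\rangle-b_i)$. For closed $\Omega$, $X\in\Omega$: $\mathrm{T}^B_\Omega(X)$ is the set of $\Xi$ with $X^k\in\Omega$, $X^k\to X$, $t_k\downarrow0$, $(X^k-X)/t_k\to\Xi$; $\mathrm{N}^F_\Omega(X)=\{Y:\langle Y,\Xi\rangle\le0\ \forall\Xi\in\mathrm{T}^B_\Omega(X)\}$. $X$ is an $F$-stationary point of (rank-MOA) if $X\in\mathcal{M}(r)$ and there is $y\in\mathbb{R}^l$ with $\mathcal{A}(X)=b$ and $-\nabla_XL(X;y)\in\mathrm{N}^F_{\mathcal{M}(r)}(X)$. SVD convention: $X=U\Sigma V^\top$, $U$, $V$ orthogonal of sizes $m$, $n$, $\Sigma$ with diagonal $\sigma_1\ge\dots\ge\sigma_s>0$ followed by zeros, $\Gamma=\{1,\dots,s\}$, $\Gamma_m^\perp=\{s+1,\dots,m\}$, $\Gamma_n^\perp=\{s+1,\dots,n\}$, $U_J,V_J$ column submatrices indexed by $J$.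 $T^i_X=\begin{bmatrix}U_\Gamma^\top A^iV_\Gamma & U_\Gamma^\top A^iV_{\Gamma_n^\perp}\\ U_{\Gamma_m^\perp}^\top A^iV_\Gamma & O\end{bmatrix}$, $R^i_X=U^\top A^iV_\Gamma$. Assumption 1 at $X$: $T^1_X,\dots,T^l_X$ linearly independent. Assumption 2 at $X$: $R^1_X,\dots,R^l_X$ linearly independent. *)

(* Defs.v *)
From HB Require Import structures.
From mathcomp Require Import all_boot all_order all_algebra.
From mathcomp Require Import all_classical all_reals all_analysis.
Set Implicit Arguments. Unset Strict Implicit. Unset Printing Implicit Defensive.
Import Order.TTheory GRing.Theory Num.Theory.
Import numFieldNormedType.Exports.
Local Open Scope classical_set_scope.
Local Open Scope ring_scope.

Section Defs.
Variable R : realType.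

Definition frob {m n : nat} (X Y : 'M[R]_(m, n)) : R :=
  \sum_(i < m) \sum_(j < n) X i j * Y i j.

(* gradient of f at X: the matrix of partial derivatives, i.e. the
   Riesz representative of the Frechet differential 'd f X w.r.t. <.,.> *)
Definition grad {m n : nat} (f : 'M[R]_(m, n) -> R) (X : 'M[R]_(m, n))
  : 'M[R]_(m, n) := \matrix_(i, j) ('d f X (delta_mx i j)).

Definition C1 {m n : nat} (f : 'M[R]_(m, n) -> R) : Prop :=
  (forall X, differentiable f X) /\ continuous (grad f).

Definition convex_fun {m n : nat} (f : 'M[R]_(m, n) -> R) : Prop :=
  forall (X Y : 'M[R]_(m, n)) (t : R), 0 <= t -> t <= 1 ->
    f (t *: X + (1 - t) *: Y) <= t * f X + (1 - t) * f Y.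

Definition opA {m n l : nat} (A : 'I_l -> 'M[R]_(m, n)) (X : 'M[R]_(m, n))
  : 'I_l -> R := fun i => frob (A i) X.

Definition affL {m n l : nat} (A : 'I_l -> 'M[R]_(m, n)) (b : 'I_l -> R)
  : set 'M[R]_(m, n) := [set X | opA A X = b].

Definition rankset {m n : nat} (r : nat) : set 'M[R]_(m, n) :=
  [set X | (\rank X <= r)%N].

Definition bouligand {m n : nat} (Om : set 'M[R]_(m, n)) (X : 'M[R]_(m, n))
  : set 'M[R]_(m, n) :=
  [set Xi | exists (Xk : nat -> 'M[R]_(m, n)) (tk : nat -> R),
      (forall k, Om (Xk k)) /\ Xk @ \oo --> X /\
      (forall k, 0 < tk k) /\ tk @ \oo --> 0 /\
      (fun k => (tk k)^-1 *: (Xk k - X)) @ \oo --> Xi].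

Definition frechet_normal {m n : nat} (Om : set 'M[R]_(m, n)) (X : 'M[R]_(m, n))
  : set 'M[R]_(m, n) :=
  [set Y | forall Xi, bouligand Om X Xi -> frob Y Xi <= 0].

(* gradient in X of the Lagrangian L(X;y) = f(X) + sum_i y_i (<A^i,X> - b_i) *)
Definition gradL {m n l : nat} (f : 'M[R]_(m, n) -> R)
  (A : 'I_l -> 'M[R]_(m, n)) (X : 'M[R]_(m, n)) (y : 'I_l -> R) : 'M[R]_(m, n) :=
  grad f X + \sum_(i < l) y i *: A i.

Definition F_stationary {m n l : nat} (r : nat) (f : 'M[R]_(m, n) -> R)
  (A : 'I_l -> 'M[R]_(m, n)) (b : 'I_l -> R) (X : 'M[R]_(m, n)) : Prop :=
  rankset r X /\
  exists y : 'I_l -> R, opA A X = b /\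
     frechet_normal (rankset r) X (- gradL f A X y).

Definition local_minimizer {m n l : nat} (r : nat) (f : 'M[R]_(m, n) -> R)
  (A : 'I_l -> 'M[R]_(m, n)) (b : 'I_l -> R) (X : 'M[R]_(m, n)) : Prop :=
  affL A b X /\ rankset r X /\
  \forall Y \near X, (affL A b Y /\ rankset r Y) -> f X <= f Y.

Definition global_minimizer {m n l : nat} (r : nat) (f : 'M[R]_(m, n) -> R)
  (A : 'I_l -> 'M[R]_(m, n)) (b : 'I_l -> R) (X : 'M[R]_(m, n)) : Prop :=
  affL A b X /\ rankset r X /\
  forall Y, affL A b Y -> rankset r Y -> f X <= f Y.

Definition lin_indep {p q l : nat} (T : 'I_l -> 'M[R]_(p, q)) : Prop :=
  forall c : 'I_l -> R, \sum_(i < l) c i *: T i = 0 -> forall i, c i = 0.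

Definition is_svd {m n : nat} (X : 'M[R]_(m, n)) (s : nat)
  (U : 'M[R]_m) (Sig : 'M[R]_(m, n)) (V : 'M[R]_n) : Prop :=
  U^T *m U = 1%:M /\ V^T *m V = 1%:M /\
      (forall (i : 'I_m) (j : 'I_n), (i : nat) <> j -> Sig i j = 0) /\
      (forall (i : 'I_m) (j : 'I_n), (i : nat) = j -> (i < s)%N -> 0 < Sig i j) /\
      (forall (i : 'I_m) (j : 'I_n), (i : nat) = j -> (s <= i)%N -> Sig i j = 0) /\
      (forall (i1 i2 : 'I_m) (j1 j2 : 'I_n), (i1 : nat) = j1 -> (i2 : nat) = j2 ->
          (i1 <= i2)%N -> Sig i2 j2 <= Sig i1 j1) /\
  X = U *m Sig *m V^T.

Definition colG {k : nat} (s : nat) (h : (s <= k)%N) (W : 'M[R]_k) : 'M[R]_(k, s) :=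
  colsub (widen_ord h) W.
Definition colGp {k : nat} (s : nat) (h : (s <= k)%N) (W : 'M[R]_k)
  : 'M[R]_(k, k - s) :=
  colsub (fun j : 'I_(k - s) => cast_ord (subnKC h) (rshift s j)) W.

Definition TX {m n : nat} (s : nat) (hm : (s <= m)%N) (hn : (s <= n)%N)
  (U : 'M[R]_m) (V : 'M[R]_n) (Ai : 'M[R]_(m, n))
  : 'M[R]_(s + (m - s), s + (n - s)) :=
  block_mx ((colG hm U)^T *m Ai *m colG hn V) ((colG hm U)^T *m Ai *m colGp hn V)
           ((colGp hm U)^T *m Ai *m colG hn V) 0.

Definition RX {m n : nat} (s : nat) (hn : (s <= n)%N)
  (U : 'M[R]_m) (V : 'M[R]_n) (Ai : 'M[R]_(m, n)) : 'M[R]_(m, s) :=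
  U^T *m Ai *m colG hn V.

Definition MXGamma {m n : nat} (s : nat) (hn : (s <= n)%N)
  (U : 'M[R]_m) (V : 'M[R]_n) : set 'M[R]_(m, n) :=
  [set Y | exists B : 'M[R]_(m, s), Y = U *m B *m (colG hn V)^T].

End Defs.

(* Main.v *)
Require Import Defs.
From HB Require Import structures.
From mathcomp Require Import all_boot all_order all_algebra.
From mathcomp Require Import all_classical all_reals all_analysis.
From mathcomp Require Import ring lra.
Import Order.TTheory GRing.Theory Num.Theory.
Import numFieldNormedType.Exports.
Local Open Scope classical_set_scope.
Local Open Scope ring_scope.

(** Part (i), [s = r].  On a small ball around [X], minimise the penalised
    function [f Y + k |A(Y) - b|^2 + |Y - X|^2] over matrices of rank at most
    [r]; for [k] large the minimiser [Y] is interior to the ball.  The lines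
    [(1 + t P) Y] and [Y (1 + t Q)] stay in the rank set, so the gradient at [Y]
    is orthogonal to every [P Y + Y Q], with multipliers [2 k (A(Y) - b)].
    Assumption 1 makes a Gram matrix invertible at [X], which lets one eliminate
    these multipliers by Cramer's rule and pass to the limit [Y -> X] without an
    implicit function theorem.  The outcome is [G X^T = 0] and [X^T G = 0] for
    the gradient [G] of the Lagrangian, which makes [G] orthogonal to the tangent
    cone.

    Part (i), [s < r].  For every rank-one [E], the linear space of matrices
    [C V_Gamma^T + t E] consists of matrices of rank at most [r] and contains
    [X].  By Assumption 2 the constraints can be corrected inside
    [C V_Gamma^T], hence with multipliers that do not depend on [E]; so [G = 0].

    Part (ii).  Convexity gives [f Y - f X >= <G, Y - X>] for feasible [Y].  If
    [s = r], the line from [X] to [Y] lies in the rank set; if [s < r], the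
    tangent cone contains all rank-one matrices, so [G = 0]. *)

Set Implicit Arguments.
Unset Strict Implicit.
Unset Printing Implicit Defensive.

(** * Algebra of the Frobenius inner product *)

Section FrobeniusProduct.
Variable R : realType.

Lemma frobE m n (X Y : 'M[R]_(m, n)) : frob X Y = \tr (X^T *m Y).
Proof.
rewrite /frob /mxtrace exchange_big; apply: eq_bigr => j _.
by rewrite mxE; apply: eq_bigr => i _; rewrite mxE.
Qed.

Lemma frobC m n (X Y : 'M[R]_(m, n)) : frob X Y = frob Y X.
Proof. by apply: eq_bigr => i _; apply: eq_bigr => j _; rewrite mulrC. Qed.

Lemma frobDr m n (X Y Z : 'M[R]_(m, n)) : frob X (Y + Z) = frob X Y + frob X Z.
Proof. by rewrite !frobE mulmxDr mxtraceD. Qed.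

Lemma frobZr m n a (X Y : 'M[R]_(m, n)) : frob X (a *: Y) = a * frob X Y.
Proof. by rewrite !frobE -scalemxAr mxtraceZ. Qed.

Lemma frobNr m n (X Y : 'M[R]_(m, n)) : frob X (- Y) = - frob X Y.
Proof. by rewrite -scaleN1r frobZr mulN1r. Qed.

Lemma frobBr m n (X Y Z : 'M[R]_(m, n)) : frob X (Y - Z) = frob X Y - frob X Z.
Proof. by rewrite frobDr frobNr. Qed.

Lemma frob0r m n (X : 'M[R]_(m, n)) : frob X 0 = 0.
Proof. by rewrite frobE mulmx0 mxtrace0. Qed.

Lemma frob_sumr m n (I : finType) (X : 'M[R]_(m, n)) (Y : I -> 'M[R]_(m, n)) :
  frob X (\sum_i Y i) = \sum_i frob X (Y i).
Proof. exact: (big_morph (frob X) (frobDr X) (frob0r X)). Qed.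

Lemma frobDl m n (X Y Z : 'M[R]_(m, n)) : frob (X + Y) Z = frob X Z + frob Y Z.
Proof. by rewrite !(frobC _ Z) frobDr. Qed.

Lemma frobZl m n a (X Y : 'M[R]_(m, n)) : frob (a *: X) Y = a * frob X Y.
Proof. by rewrite !(frobC _ Y) frobZr. Qed.

Lemma frobNl m n (X Y : 'M[R]_(m, n)) : frob (- X) Y = - frob X Y.
Proof. by rewrite !(frobC _ Y) frobNr. Qed.

Lemma frob0l m n (X : 'M[R]_(m, n)) : frob 0 X = 0.
Proof. by rewrite frobC frob0r. Qed.

Lemma frob_suml m n (I : finType) (X : I -> 'M[R]_(m, n)) (Y : 'M[R]_(m, n)) :
  frob (\sum_i X i) Y = \sum_i frob (X i) Y.
Proof. by rewrite frobC frob_sumr; apply: eq_bigr => i _; exact: frobC. Qed.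

Lemma frob_mulmxl m n p (G : 'M[R]_(m, n)) (P : 'M[R]_(m, p)) (Y : 'M[R]_(p, n)) :
  frob G (P *m Y) = frob (G *m Y^T) P.
Proof. by rewrite !frobE trmx_mul trmxK mulmxA mxtrace_mulC mulmxA. Qed.

Lemma frob_mulmxr m n p (G : 'M[R]_(m, n)) (Y : 'M[R]_(m, p)) (Q : 'M[R]_(p, n)) :
  frob G (Y *m Q) = frob (Y^T *m G) Q.
Proof. by rewrite !frobE trmx_mul trmxK mulmxA. Qed.

Lemma frob_delta m n (G : 'M[R]_(m, n)) i j : frob G (delta_mx i j) = G i j.
Proof.
rewrite /frob (bigD1 i) //= (bigD1 j) //= mxE !eqxx mulr1 !big1 ?addr0 //.
- by move=> i' /negPf ne; rewrite big1 // => j' _; rewrite mxE ne mulr0.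
- by move=> j' /negPf ne; rewrite mxE ne andbF mulr0.
Qed.

Lemma frob_entry_le m n (X : 'M[R]_(m, n)) i j : X i j ^+ 2 <= frob X X.
Proof.
rewrite /frob (bigD1 i) //= (bigD1 j) //= -expr2 -addrA lerDl addr_ge0 //.
  by apply: sumr_ge0 => j' _; rewrite -expr2 sqr_ge0.
by apply: sumr_ge0 => i' _; apply: sumr_ge0 => j' _; rewrite -expr2 sqr_ge0.
Qed.

Lemma frob_ge0 m n (X : 'M[R]_(m, n)) : 0 <= frob X X.
Proof.
by apply: sumr_ge0 => i _; apply: sumr_ge0 => j _; rewrite -expr2 sqr_ge0.
Qed.

Lemma frob_eq0 m n (X : 'M[R]_(m, n)) : frob X X = 0 -> X = 0.
Proof.
move=> X0; apply/matrixP => i j; rewrite mxE; apply/eqP.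
rewrite -sqrf_eq0; apply/eqP/le_anti; rewrite sqr_ge0 andbT -X0.
exact: frob_entry_le.
Qed.

(** Testing with [P = G X^T], [Q = 0] gives the squared norm of [G X^T]; testing with [P = 0],
    [Q = X^T G] gives that of [X^T G]. *)
Lemma frob_mulmx_orth m n (G : 'M[R]_(m, n)) (X : 'M[R]_(m, n)) :
  (forall P Q, frob G (P *m X + X *m Q) = 0) -> G *m X^T = 0 /\ X^T *m G = 0.
Proof.
move=> orth; split; apply: frob_eq0.
  by rewrite -frob_mulmxl; have := orth (G *m X^T) 0; rewrite mulmx0 addr0.
by rewrite -frob_mulmxr; have := orth 0 (X^T *m G); rewrite mul0mx add0r.
Qed.

End FrobeniusProduct.

(** * Limits of matrix-valued maps along a filter *)

Section MatrixLimits.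
Variable R : realType.
Context {T : Type} {F : set_system T} {FF : Filter F}.

Lemma cvg_mxP m n (f : T -> 'M[R]_(m, n)) (L : 'M[R]_(m, n)) :
  (forall i j, f x i j @[x --> F] --> L i j) <-> f @ F --> L.
Proof.
split=> [fL A [P LP PA]|fL i j]; last first.
  exact: (cvg_comp _ _ fL (@coord_continuous _ _ _ i j L)).
have /filterS : [set x | forall i j, P i j (f x i j)] `<=` f @^-1` A.
  by move=> x Px; apply: PA.
apply; suff : F [set x | forall i, forall j, P i j (f x i j)] by [].
apply: filter_forall => i; apply: filter_forall => j; exact: (fL i j _ (LP i j)).
Qed.

Lemma cvg_sum (I : Type) (r : seq I) (P : pred I) (f : I -> T -> R) (L : I -> R) :
  (forall i, P i -> f i x @[x --> F] --> L i) ->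
  \sum_(i <- r | P i) f i x @[x --> F] --> \sum_(i <- r | P i) L i.
Proof. by apply: cvg_big => -[x y]; exact: (@add_continuous R (x, y)). Qed.

Lemma cvg_prodr (I : Type) (r : seq I) (P : pred I) (f : I -> T -> R) (L : I -> R) :
  (forall i, P i -> f i x @[x --> F] --> L i) ->
  \prod_(i <- r | P i) f i x @[x --> F] --> \prod_(i <- r | P i) L i.
Proof. by apply: cvg_big => -[x y]; exact: (@mul_continuous R (x, y)). Qed.

Lemma cvg_mulmx m n p (f : T -> 'M[R]_(m, n)) (g : T -> 'M[R]_(n, p))
    (L : 'M[R]_(m, n)) (M : 'M[R]_(n, p)) :
  f @ F --> L -> g @ F --> M -> f x *m g x @[x --> F] --> L *m M.
Proof.
move=> /cvg_mxP fL /cvg_mxP gM; apply/cvg_mxP => i j; rewrite mxE.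
under eq_cvg do rewrite mxE.
by apply: cvg_sum => k _; apply: cvgM.
Qed.

Lemma cvg_frob m n (f g : T -> 'M[R]_(m, n)) (L M : 'M[R]_(m, n)) :
  f @ F --> L -> g @ F --> M -> frob (f x) (g x) @[x --> F] --> frob L M.
Proof.
move=> /cvg_mxP fL /cvg_mxP gM.
by apply: cvg_sum => i _; apply: cvg_sum => j _; apply: cvgM.
Qed.

Lemma cvg_frob_dist m n (f : T -> 'M[R]_(m, n)) (X L : 'M[R]_(m, n)) :
  f @ F --> L -> frob (f x - X) (f x - X) @[x --> F] --> frob (L - X) (L - X).
Proof.
by move=> fL; apply: cvg_frob; (apply: cvgB; [exact: fL|exact: cvg_cst]).
Qed.

Lemma cvg_det n (f : T -> 'M[R]_n) (L : 'M[R]_n) :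
  f @ F --> L -> \det (f x) @[x --> F] --> \det L.
Proof.
move=> /cvg_mxP fL; apply: cvg_sum => s _; apply: cvgM; first exact: cvg_cst.
by apply: cvg_prodr => i _; apply: fL.
Qed.

Lemma cvg_adj n (f : T -> 'M[R]_n) (L : 'M[R]_n) :
  f @ F --> L -> \adj (f x) @[x --> F] --> \adj L.
Proof.
move=> /cvg_mxP fL; apply/cvg_mxP => i j; rewrite mxE.
under eq_cvg do rewrite mxE.
apply: cvgM; first exact: cvg_cst.
apply: cvg_det; apply/cvg_mxP => i' j'; rewrite !mxE.
by under eq_cvg do rewrite !mxE; apply: fL.
Qed.

End MatrixLimits.

Lemma continuous_mx (R : realType) (U : topologicalType) m n
    (g : U -> 'M[R]_(m, n)) :
  (forall i j, continuous (fun x => g x i j)) -> continuous g.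
Proof. by move=> gc x; apply/cvg_mxP => i j; exact: gc. Qed.

(** * The set of matrices of bounded rank and its tangent cone *)

Section RankSet.
Variable R : realType.

(* Invertible for [Z] near [X], and carries the column space of [X] into that
   of [Z]. *)
Definition column_transport m n (X Z : 'M[R]_(m, n)) : 'M[R]_m :=
  1%:M + (Z - X) *m pinvmx X.

Lemma column_transport_mul m n (X Z : 'M[R]_(m, n)) :
  column_transport X Z *m X = Z *m (pinvmx X *m X).
Proof.
have XE : X *m (pinvmx X *m X) = X by rewrite mulmxA mulmxKpV.
by rewrite /column_transport mulmxDl mul1mx
  -(mulmxA (Z - X)) mulmxBl XE addrC subrK.
Qed.

Lemma cvg_column_transport m n (X : 'M[R]_(m, n)) T (F : set_system T)
    {FF : Filter F} (Z : T -> 'M[R]_(m, n)) :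
  Z @ F --> X -> column_transport X (Z x) @[x --> F] --> (1%:M : 'M[R]_m).
Proof.
move=> ZX; rewrite -[X in _ --> X]addr0; apply: cvgD; first exact: cvg_cst.
rewrite -(mul0mx _ (pinvmx X)) -(subrr X); apply: cvg_mulmx; last exact: cvg_cst.
by apply: cvgB => //; exact: cvg_cst.
Qed.

Lemma near_column_transport_unit m n (X : 'M[R]_(m, n)) T (F : set_system T)
    {FF : Filter F} (Z : T -> 'M[R]_(m, n)) :
  Z @ F --> X -> \forall x \near F, column_transport X (Z x) \in unitmx.
Proof.
move=> /cvg_column_transport/cvg_det; rewrite det1 => /cvgr_gt/(_ _ ltr01).
by apply: filterS => x d0; rewrite unitmxE unitfE gt_eqF.
Qed.

(** For [Z] near [X] the transport [W] is invertible, so [W X] has the rank of [X]; but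
    [W X = Z (X^+ X)], with [X^+] for [pinvmx X], has rank at most that of [Z]. *)
Lemma mxrank_lower_semicontinuous m n (X : 'M[R]_(m, n)) :
  \forall Z \near X, (\rank X <= \rank Z)%N.
Proof.
have uX : \forall Z \near X, column_transport X Z \in unitmx.
  exact: (@near_column_transport_unit _ _ X _ (nbhs X) _ id).
apply: filterS uX => Z uW.
have rfW : row_free (column_transport X Z)^T by rewrite row_free_unit unitmx_tr.
rewrite -mxrank_tr -(mxrankMfree _ rfW) -trmx_mul mxrank_tr.
by rewrite column_transport_mul mxrankM_maxl.
Qed.

Lemma closed_rankset m n r : closed (rankset r : set 'M[R]_(m, n)).
Proof.
move=> X /(_ _ (mxrank_lower_semicontinuous X)) [Z [Zr XZ]].
exact: leq_trans XZ Zr.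
Qed.

(** With [W] the transport, [Z = W X Q^T] for some [Q], hence [adj(W) Z = det(W) X Q^T], which is
    orthogonal to [G] because [X^T G = 0]; and [adj(W) X] is orthogonal to [G] because [G X^T = 0].
    The adjugate replaces the inverse since it is continuous everywhere. *)
Lemma frob_adj_perturbation m n (G X Z : 'M[R]_(m, n)) :
  G *m X^T = 0 -> X^T *m G = 0 -> column_transport X Z \in unitmx ->
  (\rank Z <= \rank X)%N ->
  frob G (\adj (column_transport X Z) *m (Z - X)) = 0.
Proof.
move=> GX XG uW rZ.
have GTX : G^T *m X = 0 by rewrite -[X]trmxK -trmx_mul XG trmx0.
(* The column space of [W X] lies in that of [Z]; the rank bound on [Z] forces equality. *)
have /submxP [Q ZE] : (Z^T <= (column_transport X Z *m X)^T)%MS.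
  have sub : ((column_transport X Z *m X)^T <= Z^T)%MS.
    by rewrite column_transport_mul trmx_mul submxMl.
  have [le1 <-] := mxrank_leqif_sup sub; rewrite eqn_leq le1 /= mxrank_tr.
  apply: leq_trans rZ _; rewrite trmx_mul mxrankMfree ?mxrank_tr //.
  by rewrite row_free_unit unitmx_tr.
have {}ZE : Z = column_transport X Z *m X *m Q^T.
  by rewrite -[LHS]trmxK ZE trmx_mul trmxK.
rewrite mulmxBr frobBr !frobE {2}ZE !mulmxA -(mulmxA G^T) mul_adj_mx.
rewrite mul_mx_scalar -!scalemxAl GTX mul0mx scaler0 mxtrace0 sub0r.
rewrite -mulmxA mxtrace_mulC -mulmxA -[X]trmxK -trmx_mul GX trmx0.
by rewrite mulmx0 mxtrace0 oppr0.
Qed.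

(** The transported difference quotients are eventually orthogonal to [G], and since the transports
    tend to the identity, these quotients tend to [Xi]. *)
Lemma bouligand_rankset_orth m n (G X Xi : 'M[R]_(m, n)) :
  G *m X^T = 0 -> X^T *m G = 0 -> bouligand (rankset (\rank X)) X Xi ->
  frob G Xi = 0.
Proof.
move=> GX XG [Z [t [rZ [ZX [t0 [_ ZXi]]]]]].
pose q k := frob G (\adj (column_transport X (Z k)) *m ((t k)^-1 *: (Z k - X))).
have q0 : q @ \oo --> 0.
  have uW : \forall k \near \oo, column_transport X (Z k) \in unitmx.
    by exact: near_column_transport_unit ZX.
  apply: cvg_near_cst; apply: filterS uW => k uW.
  by rewrite /q -scalemxAr frobZr frob_adj_perturbation ?mulr0 //; exact: rZ.
have qL : q @ \oo --> frob G (\adj 1%:M *m Xi).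
  apply: cvg_frob; first exact: cvg_cst.
  by apply: cvg_mulmx => //; apply: cvg_adj; exact: cvg_column_transport.
have := cvg_unique (@Rhausdorff R) qL q0.
rewrite -[\adj _]mul1mx mul_mx_adj det1 mul1mx; apply.
Qed.

Lemma bouligand_ray m n (Om : set 'M[R]_(m, n)) (X Xi : 'M[R]_(m, n)) :
  (forall t, Om (X + t *: Xi)) -> bouligand Om X Xi.
Proof.
move=> ray; pose t k : R := k.+1%:R^-1.
have t0 : t @ \oo --> 0 by exact: cvg_harmonic.
exists (fun k => X + t k *: Xi), t; split; first by move=> k; exact: ray.
split.
  rewrite -[X in _ --> X]addr0 -(scale0r Xi).
  by apply: cvgD; [exact: cvg_cst|apply: cvgZr_tmp].
split; first by move=> k; rewrite invr_gt0 ltr0n.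
split=> //; apply: cvg_near_cst; apply: nearW => k.
by rewrite addrC addKr scalerA mulVf ?scale1r // invr_eq0 pnatr_eq0.
Qed.

End RankSet.

(** * One-sided directional derivatives and first-order conditions *)

Section FirstOrder.
Variable R : realType.

Lemma cvg_ray m n (X Xi : 'M[R]_(m, n)) : X + t *: Xi @[t --> 0^'+] --> X.
Proof.
apply: cvg_at_right_filter; rewrite -[X in _ --> X]addr0 -(scale0r Xi).
by apply: cvgD; [exact: cvg_cst|apply: cvgZr_tmp; exact: cvg_id].
Qed.

Lemma cvg_directional m n (f : 'M[R]_(m, n) -> R) (X Xi : 'M[R]_(m, n)) :
  differentiable f X ->
  t^-1 * (f (X + t *: Xi) - f X) @[t --> 0^'+] --> frob (grad f X) Xi.
Proof.
move=> df.
have -> : frob (grad f X) Xi = 'D_Xi f X.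
  rewrite deriveE // [in RHS](matrix_sum_delta Xi) linear_sum /=.
  apply: eq_bigr => i _; rewrite linear_sum; apply: eq_bigr => j _.
  by rewrite linearZ mxE mulrC.
have /cvg_ex [L hL] := @diff_derivable _ _ _ _ _ Xi df.
have -> : 'D_Xi f X = L by exact: cvg_lim hL.
move=> A /hL; rewrite /nbhs /= /fmap /at_right /dnbhs /within /=.
rewrite !near_simpl; apply: filterS => t At t0.
by rewrite (addrC X); apply: At; rewrite gt_eqF.
Qed.

(** The term [t * (c + t * d)] is the exact increment of a quadratic along a line; dividing by [t]
    leaves [c] in the limit. *)
Lemma first_order_necessary m n (f : 'M[R]_(m, n) -> R) (X Xi : 'M[R]_(m, n)) c d :
  differentiable f X ->
  (\forall t \near 0^'+, 0 <= f (X + t *: Xi) - f X + t * (c + t * d)) ->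
  0 <= frob (grad f X) Xi + c.
Proof.
move=> /cvg_directional df fge.
have cd : c + t * d @[t --> 0^'+] --> c.
  apply: cvg_at_right_filter.
  rewrite -[X in _ --> X]addr0 -[X in _ --> _ + X](mul0r d).
  by apply: cvgD; [exact: cvg_cst|apply: cvgM; [exact: cvg_id|exact: cvg_cst]].
apply: (cvgr_to_ge (cvgD (df Xi) cd)).
near=> t; have t0 : 0 < t by [].
have tn0 : t != 0 by rewrite gt_eqF.
suff : 0 <= t^-1 * (f (X + t *: Xi) - f X + t * (c + t * d)).
  by rewrite mulrDr mulKf.
apply: mulr_ge0; first by rewrite invr_ge0 ltW.
by near: t; exact: fge.
Unshelve. all: by end_near. Qed.

Lemma convex_first_order m n (f : 'M[R]_(m, n) -> R) (X Y : 'M[R]_(m, n)) :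
  convex_fun f -> differentiable f X -> frob (grad f X) (Y - X) <= f Y - f X.
Proof.
move=> cf df; have dfY := cvg_directional (Xi := Y - X) df.
apply: (cvgr_to_le dfY).
near=> t; have t0 : 0 < t by [].
have t1 : t <= 1 by near: t; apply: nbhs_right_le.
rewrite ler_pdivrMl // (_ : X + _ = t *: Y + (1 - t) *: X); last first.
  by rewrite scalerBr scalerBl scale1r addrCA addrA.
by have := cf Y X t (ltW t0) t1; lra.
Unshelve. all: by end_near. Qed.

End FirstOrder.

(** * Penalised problems on a small ball *)

Section Penalty.
Variable R : realType.

Lemma continuous_frob_dist m n (X : 'M[R]_(m, n)) :
  continuous (fun Y : 'M[R]_(m, n) => frob (Y - X) (Y - X)).
Proof.
by move=> Y; exact: (@cvg_frob_dist _ _ (nbhs Y) _ _ _ id).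
Qed.

Lemma compact_frob_ball m n (X : 'M[R]_(m, n)) e :
  compact [set Y : 'M[R]_(m, n) | frob (Y - X) (Y - X) <= e].
Proof.
(* Each entry of [Y - X] has square at most [e <= M <= M ^+ 2], the last step because [1 <= M].
   Compactness is that of a box of row vectors, carried over by [vec_mx]. *)
pose M := 1 + `|e|; pose shift_vec (v : 'rV[R]_(m * n)) := X + vec_mx v.
pose box := [set v : 'rV[R]_(m * n) | forall i, `[- M, M]%classic (v ord0 i)].
have cbox : compact (shift_vec @` box).
  apply: continuous_compact; last first.
    apply: (@rV_compact R (m * n) (fun=> `[- M, M]%classic)) => _.
    exact: segment_compact.
  apply: continuous_subspaceT; apply: continuous_mx => i j.
  have vE w : shift_vec w i j = X i j + w 0 (mxvec_index i j).
    by rewrite mxE -(mxvecE (vec_mx w)) vec_mxK.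
  rewrite (funext vE) => v.
  by apply: (cvgD (F := nbhs v)); [exact: cvg_cst|exact: coord_continuous].
apply: (subclosed_compact _ cbox).
  apply: (@preimage_closed _ _ (fun Y : 'M[R]_(m, n) => frob (Y - X) (Y - X))
    [set x | x <= e]).
    by move=> Y _; exact: continuous_frob_dist.
  exact: closed_le.
move=> Y /= Ye; exists (mxvec (Y - X)); last first.
  by rewrite /shift_vec mxvecK addrC subrK.
move=> k /=; case/mxvec_indexP: k => i j; rewrite mxvecE in_itv /= -ler_norml.
have M1 : 1 <= M by rewrite lerDl.
have M0 : 0 <= M by apply: le_trans M1.
rewrite -(@ler_pXn2r _ 2) ?nnegrE // real_normK ?num_real //.
apply: (le_trans (frob_entry_le (Y - X) i j)); apply: (le_trans Ye).
apply: (@le_trans _ _ M); last by rewrite expr2 ler_peMl.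
by rewrite (le_trans (ler_norm e)) // lerDr.
Qed.

Lemma nbhs_frob_ball m n (X : 'M[R]_(m, n)) B :
  nbhs X B -> exists2 e, 0 < e &
    forall Y : 'M[R]_(m, n), frob (Y - X) (Y - X) <= e -> B Y.
Proof.
move=> /nbhs_ballP [e /= e0 eB]; exists ((e / 2) ^+ 2).
  by rewrite exprn_gt0 // divr_gt0.
move=> Y Ye; apply: eB; split=> // i j; rewrite /ball /=.
have e2 : 0 <= e / 2 by rewrite divr_ge0 // ltW.
apply: (@le_lt_trans _ _ (e / 2)); last by rewrite ltr_pdivrMr // ltr_pMr // ltr1n.
rewrite -(@ler_pXn2r _ 2) ?nnegrE // real_normK ?num_real // -sqrrN opprB.
by apply: le_trans Ye; have := frob_entry_le (Y - X) i j; rewrite !mxE.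
Qed.

(** Compactness, in its near-covering form, turns a local choice of large [k] into a uniform one.
    Where [p x = 0], the bound on [g] persists nearby; where [p x > 0], [p] stays above [p x / 2]
    and a large [k] suffices. *)
Lemma penalty_gap (T : topologicalType) (K : set T) (g p : T -> R) a :
  compact K -> continuous g -> continuous p -> (forall x, 0 <= p x) ->
  (forall x, K x -> p x = 0 -> a < g x) ->
  exists2 k, 0 <= k & forall x, K x -> a < g x + k * p x.
Proof.
move=> /compact_near_coveringP cK cg cp p0 gp.
have : \forall k \near +oo, K `<=` [set x | 0 <= k /\ a < g x + k * p x].
  apply: cK => x Kx; have [px|px] := eqVneq (p x) 0.
    exists ([set y | a < g y], [set k | 0 <= k]).
      split; first exact: (cvgr_gt (g x) (cg x) _ (gp x Kx px)).
      by apply: nbhs_pinfty_ge; exact: num_real.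
    move=> [y k] /= [ay k0]; split=> //.
    by apply: (lt_le_trans ay); rewrite lerDl mulr_ge0.
  have px0 : 0 < p x by rewrite lt_neqAle eq_sym px p0.
  have d0 : 0 < p x / 2 by rewrite divr_gt0.
  exists ([set y | g x - 1 < g y] `&` [set y | p x / 2 < p y],
          [set k | 0 <= k] `&` [set k | (a - g x + 1) / (p x / 2) <= k]).
    split; apply: filterI.
    - by apply: (cvgr_gt (g x) (cg x)); rewrite ltrBlDr ltrDl.
    - by apply: (cvgr_gt (p x) (cp x)); rewrite ltr_pdivrMr // ltr_pMr // ltr1n.
    - by apply: nbhs_pinfty_ge; exact: num_real.
    - by apply: nbhs_pinfty_ge; exact: num_real.
  move=> [y k] /= [[gy py] [k0]]; rewrite ler_pdivrMr // => ka; split=> //.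
  have : k * (p x / 2) <= k * p y by rewrite ler_wpM2l // ltW.
  by lra.
move=> near_k.
(* The sign of [k] is recorded separately because [K] may be empty. *)
have : \forall k \near +oo, 0 <= k /\ K `<=` [set x | 0 <= k /\ a < g x + k * p x].
  by near=> k; split; near: k => //; apply: nbhs_pinfty_ge; exact: num_real.
by move=> /filter_ex [k [k0 Kk]]; exists k => // x /Kk [].
Unshelve. all: by end_near. Qed.

Variables (m n l r : nat) (f : 'M[R]_(m, n) -> R).
Variables (A : 'I_l -> 'M[R]_(m, n)) (b : 'I_l -> R) (X : 'M[R]_(m, n)).
Hypotheses (f_C1 : C1 f) (feasX : affL A b X) (rankX : rankset r X).

Definition infeasibility Y := \sum_i (frob (A i) Y - b i) ^+ 2.

Lemma continuous_infeasibility : continuous infeasibility.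
Proof.
move=> Y; apply: (cvg_sum (F := nbhs Y)) => i _.
rewrite expr2; under eq_cvg do rewrite expr2.
have AY : frob (A i) Z @[Z --> Y] --> frob (A i) Y.
  by apply: (@cvg_frob _ _ (nbhs Y) _ _ _ (fun=> A i) id) => //; exact: cvg_cst.
by apply: (cvgM (F := nbhs Y)); apply: (cvgB (F := nbhs Y)) => //; exact: cvg_cst.
Qed.

Lemma infeasibility_ge0 Y : 0 <= infeasibility Y.
Proof. by apply: sumr_ge0 => i _; rewrite sqr_ge0. Qed.

Lemma infeasibility_eq0 Y : infeasibility Y = 0 <-> affL A b Y.
Proof.
split=> [/eqP|YL]; last first.
  by rewrite /infeasibility big1 // => i _; rewrite -YL subrr expr0n.
rewrite psumr_eq0; last by move=> i _; rewrite sqr_ge0.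
move=> /allP Y0; apply/funext => i; apply/eqP; rewrite -subr_eq0 -sqrf_eq0.
by apply: Y0; rewrite mem_index_enum.
Qed.

Definition sqdist (Y : 'M[R]_(m, n)) := frob (Y - X) (Y - X).

(** On the boundary sphere, feasible points have [f Y + sqdist Y > f X], so [penalty_gap] gives a
    [k] for which the penalised function exceeds [f X], its value at [X], on the whole sphere. A
    minimiser over the compact ball section is thus interior. *)
Lemma penalized_minimizer e : 0 < e ->
  (forall Y, sqdist Y <= e -> affL A b Y -> rankset r Y -> f X <= f Y) ->
  exists k Y, [/\ rankset r Y, sqdist Y < e &
    forall Z, rankset r Z -> sqdist Z <= e ->
    f Y + (k * infeasibility Y + sqdist Y)
      <= f Z + (k * infeasibility Z + sqdist Z)].
Proof.
move=> e0 Xmin; pose K := [set Y | sqdist Y <= e] `&` rankset r.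
have cf : continuous f by move=> Y; apply: differentiable_continuous; exact: f_C1.1.
have cdist : continuous sqdist := @continuous_frob_dist _ _ X.
have cK : compact K.
  by apply: compact_closedI; [exact: compact_frob_ball|exact: closed_rankset].
(* Within [K] the condition [e <= sqdist Y] cuts out exactly the sphere. *)
have csphere : compact (K `&` [set Y | e <= sqdist Y]).
  apply: compact_closedI => //.
  apply: (@preimage_closed _ _ sqdist [set x | e <= x]).
    by move=> Y _; exact: cdist.
  exact: closed_ge.
have cfd : continuous (fun Y => f Y + sqdist Y).
  by move=> Y; apply: (cvgD (F := nbhs Y)); [exact: cf|exact: cdist].
have gap0 Y : (K `&` [set Y | e <= sqdist Y]) Y -> infeasibility Y = 0 ->
    f X < f Y + sqdist Y.
  move=> [[Ye Yr] /= eY] /infeasibility_eq0 YL.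
  by apply: ltr_pwDr; [exact: lt_le_trans eY|exact: Xmin].
have [k k0 gap] :=
  penalty_gap csphere cfd continuous_infeasibility infeasibility_ge0 gap0.
pose phi Y := f Y + (k * infeasibility Y + sqdist Y).
have dX : sqdist X = 0 by rewrite /sqdist subrr frob0r.
have KX : K X by split=> //=; rewrite dX ltW.
have [Y KY Ymin] : exists2 Y, Y \in K & forall Z, Z \in K -> phi Y <= phi Z.
  apply: compact_EVT_min => //; first by exists X.
  apply: continuous_subspaceT => Y; apply: (cvgD (F := nbhs Y)); first exact: cf.
  apply: (cvgD (F := nbhs Y)); last exact: cdist.
  by apply: (cvgM (F := nbhs Y)); [exact: cvg_cst|exact: continuous_infeasibility].
exists k, Y; move: KY; rewrite inE => -[/= Ye Yr]; split=> //; last first.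
  by move=> Z Zr Ze; apply: Ymin; rewrite inE.
rewrite ltNge; apply/negP => eY; have := gap Y (conj (conj Ye Yr) eY).
have : phi Y <= phi X by apply: Ymin; rewrite inE.
rewrite /phi dX; have -> : infeasibility X = 0 by apply/infeasibility_eq0.
by lra.
Qed.

Lemma penalized_stationary e : 0 < e ->
  (forall Y, sqdist Y <= e -> affL A b Y -> rankset r Y -> f X <= f Y) ->
  exists Y (y : 'I_l -> R), sqdist Y < e /\ forall P Q,
    frob (grad f Y + 2 *: (Y - X) + \sum_i y i *: A i) (P *m Y + Y *m Q) = 0.
Proof.
move=> e0 Xmin; have [k [Y [Yr Ye Ymin]]] := penalized_minimizer e0 Xmin.
(* The derivative of [k * infeasibility] at [Y] is the combination of the [A i] with these
   coefficients. *)
pose y i := 2 * k * (frob (A i) Y - b i).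
exists Y, y; split=> //.
pose G := grad f Y + 2 *: (Y - X) + \sum_i y i *: A i.
have ge0 Xi : (forall t, rankset r (Y + t *: Xi)) -> 0 <= frob G Xi.
  move=> ray.
  (* Along [Y + t *: Xi] the penalty terms grow by exactly [t * c + t ^+ 2 * d]. *)
  pose d := k * \sum_i frob (A i) Xi ^+ 2 + frob Xi Xi.
  pose c := frob (2 *: (Y - X) + \sum_i y i *: A i) Xi.
  rewrite /G -addrA frobDl.
  apply: (@first_order_necessary _ _ _ _ _ _ _ d); first exact: f_C1.1.
  have dist_near : \forall t \near 0^'+, sqdist (Y + t *: Xi) <= e.
    have /cvgr_le : sqdist (Y + t *: Xi) @[t --> 0^'+] --> sqdist Y.
      exact: (cvg_comp _ _ (@cvg_ray _ _ _ Y Xi) (@continuous_frob_dist _ _ X Y)).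
    by apply.
  apply: filterS dist_near => t te.
  have := Ymin (Y + t *: Xi) (ray t) te.
  have -> : sqdist (Y + t *: Xi)
      = sqdist Y + t * (frob (2 *: (Y - X)) Xi) + t ^+ 2 * frob Xi Xi.
    rewrite /sqdist addrAC; move: (Y - X) => D.
    by rewrite !(frobDl, frobDr, frobZl, frobZr) (frobC Xi D); ring.
  have -> : k * infeasibility (Y + t *: Xi)
      = k * infeasibility Y + t * frob (\sum_i y i *: A i) Xi
      + t ^+ 2 * (k * \sum_i frob (A i) Xi ^+ 2).
    rewrite /infeasibility frob_suml !mulr_sumr -!big_split /=.
    apply: eq_bigr => i _; rewrite /y frobZl frobDr frobZr; ring.
  rewrite /d frobDl => h; nra.
have eq0 Xi : (forall t, rankset r (Y + t *: Xi)) -> frob G Xi = 0.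
  move=> ray; apply/le_anti; rewrite ge0 // andbT -oppr_ge0 -frobNr.
  by apply: ge0 => t; rewrite scalerN -scaleNr.
move=> P Q; rewrite frobDr !eq0 ?addr0 // => t.
- rewrite scalemxAr -[X in X + _]mulmx1 -mulmxDr /rankset /=.
  exact: leq_trans (mxrankM_maxl _ _) Yr.
- rewrite scalemxAl -[X in X + _]mul1mx -mulmxDl /rankset /=.
  exact: leq_trans (mxrankM_maxr _ _) Yr.
Qed.

End Penalty.

(** * Existence of Lagrange multipliers at a local minimiser *)

Section Multipliers.
Variable R : realType.

(** A kernel vector [v] makes the sum of the squared norms of the two combinations vanish, hence
    both combinations. Two families are needed for the pairs of [A i X^T] and [X^T A i]. *)
Lemma gram_unitmx l p q p' q'
    (B : 'I_l -> 'M[R]_(p, q)) (C : 'I_l -> 'M[R]_(p', q')) :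
  (forall c : 'I_l -> R, \sum_i c i *: B i = 0 -> \sum_i c i *: C i = 0 ->
     forall i, c i = 0) ->
  \matrix_(i, k) (frob (B i) (B k) + frob (C i) (C k)) \in unitmx.
Proof.
move=> indep; rewrite -row_free_unit; apply: inj_row_free => v vg.
have sum_eq0 : frob (\sum_i v 0 i *: B i) (\sum_i v 0 i *: B i)
    + frob (\sum_i v 0 i *: C i) (\sum_i v 0 i *: C i) = 0.
  rewrite !frob_sumr -big_split /= big1 // => k _.
  have /rowP/(_ k) := vg; rewrite !mxE => gk.
  rewrite !frobZr !frob_suml -mulrDr -big_split /= -[RHS](mulr0 (v 0 k)).
  congr (_ * _); rewrite -[RHS]gk; apply: eq_bigr => i _.
  by rewrite !mxE !frobZl mulrDr.
move/eqP: sum_eq0; rewrite paddr_eq0 ?frob_ge0 // => /andP[/eqP B0 /eqP C0].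
apply/rowP => i; rewrite mxE.
by apply: (indep (fun i => v 0 i)); apply: frob_eq0.
Qed.

Variables (m n l r : nat) (f : 'M[R]_(m, n) -> R).
Variables (A : 'I_l -> 'M[R]_(m, n)) (b : 'I_l -> R) (X : 'M[R]_(m, n)).
Hypotheses (f_C1 : C1 f) (Xmin : local_minimizer r f A b X).

Lemma near_stationary B : nbhs X B ->
  exists Y (y : 'I_l -> R), B Y /\ forall P Q,
    frob (grad f Y + 2 *: (Y - X) + \sum_i y i *: A i) (P *m Y + Y *m Q) = 0.
Proof.
have [XL [Xr Xnear]] := Xmin.
move=> nB; have [e e0 eB] := nbhs_frob_ball (filterI nB Xnear).
have [|Y [y [Ye Yst]]] := penalized_stationary f_C1 XL Xr e0.
  by move=> Y /eB [_ YX] YL Yr; exact: YX.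
by exists Y, y; split=> //; have [] := eB Y (ltW Ye).
Qed.

(* Cramer's rule makes the multipliers at nearby stationary points continuous
   functions of these points, so that they have a limit at [X]. *)
Lemma tangent_multiplier :
  (forall c : 'I_l -> R, (\sum_i c i *: A i) *m X^T = 0 ->
     X^T *m (\sum_i c i *: A i) = 0 -> forall i, c i = 0) ->
  exists y, gradL f A X y *m X^T = 0 /\ X^T *m gradL f A X y = 0.
Proof.
move=> indep.
(* Directions [P Y + Y Q] with [P = A k X^T] and [Q = X^T A k], chosen so that [M X] is the Gram
   matrix of the pairs of [A i X^T] and [X^T A i]. *)
pose D k Y := A k *m X^T *m Y + Y *m (X^T *m A k).
pose M Y := \matrix_(i, k) frob (A i) (D k Y).
pose h Y := grad f Y + 2 *: (Y - X).
pose hD Y := \row_k frob (h Y) (D k Y).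
have uM : M X \in unitmx.
  rewrite (_ : M X = \matrix_(i, k) (frob (A i *m X^T) (A k *m X^T)
      + frob (X^T *m A i) (X^T *m A k))).
    apply: gram_unitmx => c cA cX; apply: indep.
      by rewrite mulmx_suml -[RHS]cA; apply: eq_bigr => i _; rewrite scalemxAl.
    by rewrite mulmx_sumr -[RHS]cX; apply: eq_bigr => i _; rewrite scalemxAr.
  apply/matrixP => i k.
  by rewrite !mxE frobDr (frob_mulmxl _ _ X) (frob_mulmxr _ X).
(* Cramer's solution of the equation [y M(X) = - hD X]. *)
pose y i := - (\det (M X))^-1 * (hD X *m \adj (M X)) 0 i.
exists y; apply: frob_mulmx_orth => P Q.
pose Xi Y := P *m Y + Y *m Q.
(* The stationarity defect in direction [Xi Y] with multipliers eliminated, multiplied by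
   [det (M Y)]: no division occurs, so [Phi] makes sense even where [M Y] is singular. *)
pose Phi Y := \det (M Y) * frob (h Y) (Xi Y)
  - \sum_i (hD Y *m \adj (M Y)) 0 i * frob (A i) (Xi Y).
have Phi0 Y z :
    (forall P Q, frob (h Y + \sum_i z i *: A i) (P *m Y + Y *m Q) = 0) ->
    Phi Y = 0.
  move=> st.
  have hDE : hD Y = - ((\row_i z i) *m M Y).
    apply/rowP => k; apply/eqP; rewrite !mxE -addr_eq0.
    have := st (A k *m X^T) (X^T *m A k); rewrite frobDl frob_suml => stk.
    rewrite -[X in _ == X]stk; apply/eqP; congr (_ + _).
    by apply: eq_bigr => i _; rewrite !mxE frobZl.
  have := st P Q; rewrite frobDl frob_suml => stP.
  rewrite /Phi hDE mulNmx -mulmxA mul_mx_adj mul_mx_scalar.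
  rewrite -sumrN -[RHS](mulr0 (\det (M Y))) -[X in _ = _ * X]stP mulrDr.
  congr (_ + _); rewrite mulr_sumr; apply: eq_bigr => i _.
  by rewrite !mxE frobZl mulNr opprK mulrA.
have idX : Y @[Y --> X] --> X by exact: cvg_id.
have cvgPQ (P' : 'M[R]_m) (Q' : 'M[R]_n) :
    (P' *m Y + Y *m Q') @[Y --> X] --> P' *m X + X *m Q'.
  by apply: (cvgD (F := nbhs X));
    apply: (cvg_mulmx (F := nbhs X)) => //; exact: cvg_cst.
have cvgh : h Y @[Y --> X] --> h X.
  apply: (cvgD (F := nbhs X)); first exact: f_C1.2.
  apply: (cvgZl_tmp (F := nbhs X)).
  by apply: (cvgB (F := nbhs X)) => //; exact: cvg_cst.
have cvgM : M Y @[Y --> X] --> M X.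
  apply/(cvg_mxP (F := nbhs X) _ _) => i k.
  rewrite mxE; under eq_cvg do rewrite mxE.
  by apply: (cvg_frob (F := nbhs X)); [exact: cvg_cst|exact: cvgPQ].
have cvghD : hD Y @[Y --> X] --> hD X.
  apply/(cvg_mxP (F := nbhs X) _ _) => i k.
  rewrite mxE; under eq_cvg do rewrite mxE.
  by apply: (cvg_frob (F := nbhs X)); [exact: cvgh|exact: cvgPQ].
have cvgPhi : Phi Y @[Y --> X] --> Phi X.
  apply: (cvgB (F := nbhs X)).
    apply: (normed_module.cvgM (F := nbhs X)); first exact: cvg_det.
    by apply: (cvg_frob (F := nbhs X)); [exact: cvgh|exact: cvgPQ].
  apply: (cvg_sum (F := nbhs X)) => i _; apply: (normed_module.cvgM (F := nbhs X)).
    apply: (iffRL (cvg_mxP (F := nbhs X) _ _)).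
    by apply: (cvg_mulmx (F := nbhs X)) => //; exact: (cvg_adj (F := nbhs X)).
  by apply: (cvg_frob (F := nbhs X)); [exact: cvg_cst|exact: cvgPQ].
(* If [Phi X] were nonzero, [Phi] would be nonzero near [X], yet it vanishes at stationary points
   arbitrarily close to [X]. *)
have PhiX : Phi X = 0.
  apply: contrapT => /eqP PhiXn0.
  have /near_stationary [Y [z [/negP PhiYn0 /Phi0 PhiY]]] :
      \forall Y \near X, Phi Y != 0 by exact: cvgr_neq0 cvgPhi PhiXn0.
  by rewrite PhiY eqxx in PhiYn0.
have detM : \det (M X) != 0 by rewrite -unitfE -unitmxE.
rewrite /gradL frobDl frob_suml.
have hX : h X = grad f X by rewrite /h subrr scaler0 addr0.
apply: (mulfI detM); rewrite mulr0 mulrDr -[RHS]PhiX /Phi hX; congr (_ + _).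
rewrite mulr_sumr -sumrN; apply: eq_bigr => i _.
by rewrite frobZl /y !mulrA mulrN mulfV // mulN1r mulNr.
Qed.

Lemma column_space_multiplier s (W : 'M[R]_(n, s)) (C : 'M[R]_(m, s)) :
  X = C *m W^T -> (s < r)%N -> lin_indep (fun i => A i *m W) ->
  exists y, gradL f A X y = 0.
Proof.
move=> XE sr indep; have [XL [Xr Xnear]] := Xmin.
pose g := \matrix_(i, k) frob (A i *m W) (A k *m W).
have ug : g \in unitmx.
  (* Empty matrices serve as a trivial second family for [gram_unitmx]. *)
  pose O (i : 'I_l) : 'M[R]_0 := 0.
  have -> : g = \matrix_(i, k) (frob (A i *m W) (A k *m W) + frob (O i) (O k)).
    by apply/matrixP => i k; rewrite !mxE frob0r addr0.
  by apply: gram_unitmx => c cW _; exact: indep.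
(* The matrices [E j W^T] form a dual family to the [A i]. *)
pose E j := \sum_k invmx g k j *: (A k *m W).
have AE i j : frob (A i) (E j *m W^T) = (i == j)%:R.
  have <- : (g *m invmx g) i j = (i == j)%:R by rewrite mulmxV // mxE.
  rewrite frob_mulmxl trmxK mxE frob_sumr; apply: eq_bigr => k _.
  by rewrite frobZr mxE mulrC.
exists (fun j => - frob (grad f X) (E j *m W^T)).
apply/matrixP => i j; rewrite [RHS]mxE -frob_delta; set Xi := delta_mx i j.
(* The rank-one direction corrected to preserve the constraints. The correction keeps the factor
   [W^T], so the rank along the ray is at most [s + 1 <= r]. *)
pose Z := Xi - \sum_k frob (A k) Xi *: (E k *m W^T).
have AZ k : frob (A k) Z = 0.
  rewrite frobBr frob_sumr (bigD1 k) //= frobZr AE eqxx mulr1 big1 ?addr0 ?subrr //.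
  by move=> k' /negPf ne; rewrite frobZr AE eq_sym ne mulr0.
have feas t : affL A b (X + t *: Z).
  by apply/funext => k; rewrite /opA frobDr frobZr AZ mulr0 addr0 -[b]XL.
have rk t : rankset r (X + t *: Z).
  have -> : X + t *: Z = (C - t *: \sum_k frob (A k) Xi *: E k) *m W^T + t *: Xi.
    rewrite XE mulmxBl scalerBr -scalemxAl mulmx_suml.
    under [in RHS]eq_bigr do rewrite -scalemxAl.
    by rewrite addrA addrAC.
  apply: leq_trans (mxrank_add _ _) _; apply: leq_trans sr.
  rewrite -addn1 leq_add // ?(leq_trans (mxrankM_maxl _ _)) ?rank_leq_col //.
  by rewrite (leq_trans (mxrank_scale _ _)) // mxrank_delta.
have ge0 Z' : (forall t, affL A b (X + t *: Z') /\ rankset r (X + t *: Z')) ->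
    0 <= frob (grad f X) Z'.
  move=> Z'feas; rewrite -[leRHS]addr0.
  apply: (@first_order_necessary _ _ _ _ _ _ _ 0); first exact: f_C1.1.
  have near_ray : \forall t \near 0^'+,
      affL A b (X + t *: Z') /\ rankset r (X + t *: Z') -> f X <= f (X + t *: Z').
    exact: (@cvg_ray _ _ _ X Z' _ Xnear).
  apply: filterS near_ray => t /(_ (Z'feas t)) Xle.
  by rewrite mulr0 addr0 mulr0 addr0 subr_ge0.
have Z0 : frob (grad f X) Z = 0.
  apply/le_anti; rewrite ge0 // andbT -oppr_ge0 -frobNr ge0 // => t.
  by rewrite scalerN -scaleNr.
rewrite frobDl frob_suml -[RHS]Z0 frobBr frob_sumr -sumrN; congr (_ + _).
by apply: eq_bigr => k _; rewrite frobZl frobZr mulNr mulrC.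
Qed.

End Multipliers.

(** * Consequences of the singular value decomposition *)

Section SVD.
Variables (R : realType) (m n s : nat) (X : 'M[R]_(m, n)).
Variables (U : 'M[R]_m) (Sig : 'M[R]_(m, n)) (V : 'M[R]_n).
Hypotheses (hsm : (s <= m)%N) (hsn : (s <= n)%N) (svd : is_svd X s U Sig V).

(** Columns of [Sig] with index at least [s] vanish, so only the first [s] columns of [V]
    contribute. *)
Lemma svd_MXGamma : MXGamma hsn U V X.
Proof.
have [_ [_ [offdiag [_ [tail [_ XE]]]]]] := svd.
exists (colsub (widen_ord hsn) Sig); rewrite XE -!mulmxA; congr (_ *m _).
apply/matrixP => i k; rewrite !mxE.
rewrite (bigID (fun j : 'I_n => (j < s)%N)) /= [X in _ + X]big1 ?addr0; last first.
  move=> j; rewrite -leqNgt => sj; have [ij|/eqP ij] := eqVneq (i : nat) j.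
    by rewrite tail ?mul0r ?ij.
  by rewrite offdiag ?mul0r.
by rewrite (big_ord_narrow hsn); apply: eq_bigr => j _; rewrite !mxE.
Qed.

(** After cancelling the orthogonal [V], row [i < s] of [U^T G] is killed by the positive singular
    value multiplying it. *)
Lemma svd_left_orth (G : 'M[R]_(m, n)) : X^T *m G = 0 -> (colG hsm U)^T *m G = 0.
Proof.
have [_ [VV [offdiag [pos [_ [_ XE]]]]]] := svd.
rewrite XE !trmx_mul trmxK => VSUG.
have SUG : Sig^T *m (U^T *m G) = 0.
  by move/(congr1 (mulmx V^T)): VSUG; rewrite mulmx0 !mulmxA VV mul1mx.
apply/matrixP => i k; rewrite mxE [RHS]mxE; pose j := widen_ord hsn i.
have := congr1 (fun M : 'M[R]_n => M j k) SUG.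
rewrite mxE [RHS]mxE (bigD1 (widen_ord hsm i)) //= big1 ?addr0; last first.
  by move=> i' ne; rewrite mxE offdiag ?mul0r // => e; case/eqP: ne; exact: val_inj.
rewrite mxE => /eqP; rewrite mulf_eq0 gt_eqF /=; last by apply: pos => /=.
by rewrite mxE => /eqP UG0; rewrite -[RHS]UG0; apply: eq_bigr => a _; rewrite !mxE.
Qed.

Lemma svd_right_orth (G : 'M[R]_(m, n)) : G *m X^T = 0 -> G *m colG hsn V = 0.
Proof.
have [UU [_ [offdiag [pos [_ [_ XE]]]]]] := svd.
rewrite XE !trmx_mul trmxK => GVSU.
have GVS : G *m V *m Sig^T = 0.
  by move/(congr1 (mulmxr U)): GVSU; rewrite /= mul0mx -!mulmxA UU mulmx1.
apply/matrixP => k i; rewrite mxE [RHS]mxE; pose j := widen_ord hsm i.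
have := congr1 (fun M : 'M[R]_m => M k j) GVS.
rewrite mxE [RHS]mxE (bigD1 (widen_ord hsn i)) //= big1 ?addr0; last first.
  by move=> i' ne; rewrite [Sig^T _ _]mxE offdiag ?mulr0 // => e;
    case/eqP: ne; exact/val_inj/esym.
rewrite [X in _ * X]mxE => /eqP; rewrite mulf_eq0 orbC gt_eqF /=; last first.
  by apply: pos => /=.
by rewrite mxE => /eqP GV0; rewrite -[RHS]GV0; apply: eq_bigr => a _; rewrite !mxE.
Qed.

Lemma TX_sum l (A : 'I_l -> 'M[R]_(m, n)) (c : 'I_l -> R) :
  \sum_i c i *: TX hsm hsn U V (A i) = TX hsm hsn U V (\sum_i c i *: A i).
Proof.
have TXD (B C : 'M[R]_(m, n)) :
    TX hsm hsn U V (B + C) = TX hsm hsn U V B + TX hsm hsn U V C.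
  by rewrite /TX add_block_mx !mulmxDr !mulmxDl addr0.
have TX0 : TX hsm hsn U V 0 = 0.
  by rewrite /TX !mulmx0 !mul0mx; apply/eqP; rewrite block_mx_eq0 !eqxx.
rewrite (big_morph _ TXD TX0); apply: eq_bigr => i _.
by rewrite /TX scale_block_mx scaler0 -!scalemxAr -!scalemxAl.
Qed.

(** The two products with [X^T] vanish only if [U_Gamma^T] and [V_Gamma] annihilate the combination,
    and every block of [TX] other than the zero one contains such a factor. *)
Lemma TX_indep l (A : 'I_l -> 'M[R]_(m, n)) (c : 'I_l -> R) :
  lin_indep (fun i => TX hsm hsn U V (A i)) ->
  (\sum_i c i *: A i) *m X^T = 0 -> X^T *m (\sum_i c i *: A i) = 0 ->
  forall i, c i = 0.
Proof.
move=> indep /svd_right_orth AV /svd_left_orth UA; apply: indep.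
rewrite TX_sum /TX -mulmxA AV mulmx0 UA mul0mx -mulmxA AV mulmx0.
by apply/eqP; rewrite block_mx_eq0 !eqxx.
Qed.

Lemma RX_indep l (A : 'I_l -> 'M[R]_(m, n)) :
  lin_indep (fun i => RX hsn U V (A i)) -> lin_indep (fun i => A i *m colG hsn V).
Proof.
move=> indep c cA; apply: indep.
transitivity (U^T *m \sum_i c i *: (A i *m colG hsn V)); last by rewrite cA mulmx0.
by rewrite mulmx_sumr; apply: eq_bigr => i _; rewrite /RX -scalemxAr mulmxA.
Qed.

End SVD.

(** * Normal cone at rank-deficient points, and the theorem *)

Lemma frechet_normal_rank_deficient (R : realType) m n r (X G : 'M[R]_(m, n)) :
  (\rank X < r)%N -> frechet_normal (rankset r) X G -> G = 0.
Proof.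
move=> Xr normal; apply/matrixP => i j; rewrite mxE -frob_delta.
have tangent a : bouligand (rankset r) X (a *: delta_mx i j).
  apply: bouligand_ray => t; apply: leq_trans (mxrank_add _ _) _.
  apply: leq_trans Xr; rewrite -addn1 leq_add2l scalerA.
  by rewrite (leq_trans (mxrank_scale _ _)) // mxrank_delta.
have := normal _ (tangent 1); have := normal _ (tangent (-1)).
by rewrite !frobZr mulN1r mul1r oppr_le0 => le1 le2; apply/le_anti/andP.
Qed.

Lemma gradL_feasible (R : realType) m n l (f : 'M[R]_(m, n) -> R)
    (A : 'I_l -> 'M[R]_(m, n)) b (X Y : 'M[R]_(m, n)) y :
  affL A b X -> affL A b Y ->
  frob (gradL f A X y) (Y - X) = frob (grad f X) (Y - X).
Proof.
move=> XL YL; rewrite frobDl frob_suml big1 ?addr0 // => i _.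
have AX : frob (A i) X = b i by rewrite -XL.
by rewrite frobZl frobBr AX -YL subrr mulr0.
Qed.

Theorem theorem4p1 (R : realType) (m n r l : nat)
  (hrn : (r < n)%N) (hnm : (n <= m)%N)
  (f : 'M[R]_(m, n) -> R) (hf : C1 f)
  (A : 'I_l -> 'M[R]_(m, n)) (b : 'I_l -> R)
  (X : 'M[R]_(m, n)) (hXL : affL A b X) (hXM : rankset r X)
  (s : nat) (hs : \rank X = s) (hsm : (s <= m)%N) (hsn : (s <= n)%N)
  (U : 'M[R]_m) (Sig : 'M[R]_(m, n)) (V : 'M[R]_n)
  (hsvd : is_svd X s U Sig V) :
  (* (i) *)
  (local_minimizer r f A b X ->
     ((s = r /\ lin_indep (fun i => TX hsm hsn U V (A i))) \/
      ((s < r)%N /\ lin_indep (fun i => RX hsn U V (A i)))) ->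
     F_stationary r f A b X)
  /\
  (* (ii) *)
  (convex_fun f -> F_stationary r f A b X ->
     (s = r -> forall Y, affL A b Y -> MXGamma hsn U V Y -> f X <= f Y) /\
     ((s < r)%N -> global_minimizer r f A b X)).
Proof.
have [B XE] := svd_MXGamma hsn hsvd.
split=> [Xmin cases|cvx [_ [y [_ normal]]]].
  split=> //; case: cases => [[sr indep]|[sr indep]].
    have [|y [GX XG]] := @tangent_multiplier _ _ _ _ r f A b X hf Xmin.
      by move=> c; exact: (TX_indep hsvd indep).
    exists y; split=> // Xi; rewrite -sr -hs => tangent.
    by rewrite frobNl (bouligand_rankset_orth GX XG tangent) oppr0.
  have [y G0] := column_space_multiplier hf Xmin XE sr (RX_indep indep).
  by exists y; split=> // Xi _; rewrite G0 oppr0 frob0l.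
(* On feasible differences the constraint terms of the Lagrangian gradient drop out, so the
   convexity inequality applies to it. *)
have ge_of_orth Y : affL A b Y -> 0 <= frob (gradL f A X y) (Y - X) -> f X <= f Y.
  move=> YL; rewrite (gradL_feasible _ _ hXL YL) => grad_ge0.
  rewrite -subr_ge0; apply: le_trans grad_ge0 _.
  by apply: convex_first_order => //; exact: hf.1.
split=> [sr Y YL [C YE]|sr].
  apply: ge_of_orth => //; rewrite -oppr_le0 -frobNl; apply: normal.
  apply: bouligand_ray => t.
  (* [X] and [Y] share the right factor [V_Gamma^T] of rank at most [s = r], so the whole line
     through them stays in the rank set. *)
  have -> : X + t *: (Y - X) = U *m (B + t *: (C - B)) *m (colG hsn V)^T.
    by rewrite XE YE -mulmxBl -mulmxBr scalemxAl scalemxAr -mulmxDl -mulmxDr.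
  rewrite -sr /rankset /=.
  by rewrite (leq_trans (mxrankM_maxr _ _)) // mxrank_tr rank_leq_col.
split=> //; split=> // Y YL _; apply: ge_of_orth => //.
have rX : (\rank X < r)%N by rewrite hs.
have /eqP := frechet_normal_rank_deficient rX normal.
by rewrite oppr_eq0 => /eqP ->; rewrite frob0l.
Qed.
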